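(* The category $\mathbf{L}$ is maximal; that is, for all arrow terms $g_1,g_2:A\vdash B$ of $\mathbf{L}$ of the same type such that $g_1=g_2$ does not hold in $\mathbf{L}$, the category obtained from $\mathbf{L}$ by adding $g_1=g_2$ (together with all its substitution instances) as a new axiomatic equation is a preorder.
   Context: Formulae: $\mathcal{L}$ is the set of formulae built from infinitely many propositional letters with the binary connectives $\wedge$ and $\vee$; $\xi$ stands for either $\wedge$ or $\vee$. The category $\mathbf{L}$: its objects are the formulae of $\mathcal{L}$. Arrow terms are typed expressions, where $f:A\vdash B$ means that $f$ has source $A$ and target $B$. For all formulae $A,A_1,A_2$ and $i\in\{1,2\}$ the primitive arrow terms are $\mathbf{1}_A:A\vdash A$, $\hat w_A:A\vdash A\wedge A$, $\check w_A:A\vee A\vdash A$, $\hat k^i_{A_1,A_2}:A_1\wedge A_2\vdash A_i$, $\check k^i_{A_1,A_2}:A_i\vdash A_1\vee A_2$. If $f:A\vdash B$ and $g:B\vdash C$ are arrow terms, so is $g\circ f:A\vdash C$; if $f_j:A_j\vdash B_j$ ($j=1,2$) are arrow terms, so is $f_1\mathbin{\xi}f_2:A_1\mathbin{\xi}A_2\vdash B_1\mathbin{\xi}B_2$. The equations of $\mathbf{L}$ are the smallest set of equations between arrow terms of the same type that contains all instances of $f=f$ and of the following axiomatic equations, and is closed under symmetry, transitivity and congruence with respect to $\circ$, $\wedge$ and $\vee$ on arrow terms: categorial: $f\circ\mathbf{1}_A=\mathbf{1}_B\circ f=f$ for $f:A\vdash B$, $h\circ(g\circ f)=(h\circ g)\circ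 f$; bifunctorial: $\mathbf{1}_A\mathbin{\xi}\mathbf{1}_B=\mathbf{1}_{A\xi B}$, $(g_1\circ f_1)\mathbin{\xi}(g_2\circ f_2)=(g_1\mathbin{\xi}g_2)\circ(f_1\mathbin{\xi}f_2)$; naturality (for $f:A\vdash B$, $f_j:A_j\vdash B_j$): $(f\wedge f)\circ\hat w_A=\hat w_B\circ f$, $f\circ\check w_A=\check w_B\circ(f\vee f)$, $f_i\circ\hat k^i_{A_1,A_2}=\hat k^i_{B_1,B_2}\circ(f_1\wedge f_2)$, $(f_1\vee f_2)\circ\check k^i_{A_1,A_2}=\check k^i_{B_1,B_2}\circ f_i$; triangular: $\hat k^i_{A,A}\circ\hat w_A=\mathbf{1}_A$, $\check w_A\circ\check k^i_{A,A}=\mathbf{1}_A$, $(\hat k^1_{A,B}\wedge\hat k^2_{A,B})\circ\hat w_{A\wedge B}=\mathbf{1}_{A\wedge B}$, $\check w_{A\vee B}\circ(\check k^1_{A,B}\vee\check k^2_{A,B})=\mathbf{1}_{A\vee B}$. Arrows of $\mathbf{L}$ are equivalence classes of arrow terms modulo these equations; ''$f=g$ holds in $\mathbf{L}$'' means that $f=g$ is one of these equations. A substitution instance of an arrow term (or equation) is obtained by uniformly replacing propositional letters by formulae in all the indices and types. Adding $g_1=g_2$ as a new axiomatic equation means taking the smallest set of equations that contains all the axiomatic equations above and all substitution instances of $g_1=g_2$ and is closed under the same rules; the new category has the same objects, and arrow terms modulo the enlarged set of equations as arrows. A category is a preorder when any two arrows with the same source and the same target are equal. *)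

(* Defs.v *)
From Stdlib Require Import List FinFun RelationClasses.

Set Implicit Arguments.

Inductive connective : Type := Conj | Disj.

(* [P] is the set of propositional letters. *)
Inductive formula (P : Type) : Type :=
| Letter : P -> formula P
| Bin : connective -> formula P -> formula P -> formula P.

Notation And := (Bin Conj).
Notation Or := (Bin Disj).

(* Suffix [h] stands for a hat, suffix [c] for a check. *)
Inductive term (P : Type) : formula P -> formula P -> Type :=
| One : forall A, term A A
| Wh : forall A, term A (And A A)
| Wc : forall A, term (Or A A) A
| Kh1 : forall A1 A2, term (And A1 A2) A1
| Kh2 : forall A1 A2, term (And A1 A2) A2
| Kc1 : forall A1 A2, term A1 (Or A1 A2)
| Kc2 : forall A1 A2, term A2 (Or A1 A2)
| Comp : forall A B C, term B C -> term A B -> term A C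
| BinT : forall (xi : connective) A1 A2 B1 B2,
    term A1 B1 -> term A2 B2 -> term (Bin xi A1 A2) (Bin xi B1 B2).

Notation AndT := (BinT Conj).
Notation OrT := (BinT Disj).

Definition equations (P : Type) : Type :=
  forall A B : formula P, term A B -> term A B -> Prop.

(* The equations of L enlarged by the axiomatic equations [X]. *)
Inductive holds (P : Type) (X : equations P) : equations P :=
| ax_new : forall A B (f g : term A B), X A B f g -> holds X f g
| eq_refl_ : forall A B (f : term A B), holds X f f
| eq_sym_ : forall A B (f g : term A B), holds X f g -> holds X g f
| eq_trans_ : forall A B (f g h : term A B),
    holds X f g -> holds X g h -> holds X f h
| cong_comp : forall A B C (g g' : term B C) (f f' : term A B),
    holds X g g' -> holds X f f' -> holds X (Comp g f) (Comp g' f')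
| cong_bin : forall xi A1 A2 B1 B2 (f1 f1' : term A1 B1) (f2 f2' : term A2 B2),
    holds X f1 f1' -> holds X f2 f2' ->
    holds X (BinT xi f1 f2) (BinT xi f1' f2')
| cat_right : forall A B (f : term A B), holds X (Comp f (One A)) f
| cat_left : forall A B (f : term A B), holds X (Comp (One B) f) f
| cat_assoc : forall A B C D (f : term A B) (g : term B C) (h : term C D),
    holds X (Comp h (Comp g f)) (Comp (Comp h g) f)
| bif_one : forall xi A B,
    holds X (BinT xi (One A) (One B)) (One (Bin xi A B))
| bif_comp : forall xi A1 A2 B1 B2 C1 C2
    (f1 : term A1 B1) (f2 : term A2 B2) (g1 : term B1 C1) (g2 : term B2 C2),
    holds X (BinT xi (Comp g1 f1) (Comp g2 f2))
            (Comp (BinT xi g1 g2) (BinT xi f1 f2))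
| nat_wh : forall A B (f : term A B),
    holds X (Comp (AndT f f) (Wh A)) (Comp (Wh B) f)
| nat_wc : forall A B (f : term A B),
    holds X (Comp f (Wc A)) (Comp (Wc B) (OrT f f))
| nat_kh1 : forall A1 A2 B1 B2 (f1 : term A1 B1) (f2 : term A2 B2),
    holds X (Comp f1 (Kh1 A1 A2)) (Comp (Kh1 B1 B2) (AndT f1 f2))
| nat_kh2 : forall A1 A2 B1 B2 (f1 : term A1 B1) (f2 : term A2 B2),
    holds X (Comp f2 (Kh2 A1 A2)) (Comp (Kh2 B1 B2) (AndT f1 f2))
| nat_kc1 : forall A1 A2 B1 B2 (f1 : term A1 B1) (f2 : term A2 B2),
    holds X (Comp (OrT f1 f2) (Kc1 A1 A2)) (Comp (Kc1 B1 B2) f1)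
| nat_kc2 : forall A1 A2 B1 B2 (f1 : term A1 B1) (f2 : term A2 B2),
    holds X (Comp (OrT f1 f2) (Kc2 A1 A2)) (Comp (Kc2 B1 B2) f2)
| tri_kh1 : forall A, holds X (Comp (Kh1 A A) (Wh A)) (One A)
| tri_kh2 : forall A, holds X (Comp (Kh2 A A) (Wh A)) (One A)
| tri_kc1 : forall A, holds X (Comp (Wc A) (Kc1 A A)) (One A)
| tri_kc2 : forall A, holds X (Comp (Wc A) (Kc2 A A)) (One A)
| tri_wh : forall A B,
    holds X (Comp (AndT (Kh1 A B) (Kh2 A B)) (Wh (And A B))) (One (And A B))
| tri_wc : forall A B,
    holds X (Comp (Wc (Or A B)) (OrT (Kc1 A B) (Kc2 A B))) (One (Or A B)).

Fixpoint subst_formula (P : Type) (s : P -> formula P) (A : formula P)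
  : formula P :=
  match A with
  | Letter p => s p
  | Bin xi A1 A2 => Bin xi (subst_formula s A1) (subst_formula s A2)
  end.

Fixpoint subst_term (P : Type) (s : P -> formula P) (A B : formula P)
  (f : term A B) : term (subst_formula s A) (subst_formula s B) :=
  match f with
  | One A => One (subst_formula s A)
  | Wh A => Wh (subst_formula s A)
  | Wc A => Wc (subst_formula s A)
  | Kh1 A1 A2 => Kh1 (subst_formula s A1) (subst_formula s A2)
  | Kh2 A1 A2 => Kh2 (subst_formula s A1) (subst_formula s A2)
  | Kc1 A1 A2 => Kc1 (subst_formula s A1) (subst_formula s A2)
  | Kc2 A1 A2 => Kc2 (subst_formula s A1) (subst_formula s A2)
  | Comp g f => Comp (subst_term s g) (subst_term s f)
  | BinT xi f1 f2 => BinT xi (subst_term s f1) (subst_term s f2)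
  end.

Inductive no_equations (P : Type) : equations P := .

Inductive instances (P : Type) (A B : formula P) (g1 g2 : term A B)
  : equations P :=
| instance : forall s : P -> formula P,
    instances g1 g2 (subst_term s g1) (subst_term s g2).

(* The arrows from [a] to [b] are the equivalence classes of [hom_eq] on
   [hom a b]; no quotient type is formed. *)
Record category : Type := Category {
  obj : Type;
  hom : obj -> obj -> Type;
  hom_eq : forall a b, hom a b -> hom a b -> Prop;
  ident : forall a, hom a a;
  compose : forall a b c, hom b c -> hom a b -> hom a c;
  hom_eq_equiv : forall a b, Equivalence (@hom_eq a b);
  compose_cong : forall a b c (g g' : hom b c) (f f' : hom a b),
    hom_eq g g' -> hom_eq f f' ->
    hom_eq (compose g f) (compose g' f');
  ident_right : forall a b (f : hom a b), hom_eq (compose f (ident a)) f;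
  ident_left : forall a b (f : hom a b), hom_eq (compose (ident b) f) f;
  compose_assoc : forall a b c d (f : hom a b) (g : hom b c) (h : hom c d),
    hom_eq (compose h (compose g f)) (compose (compose h g) f)
}.

Arguments hom_eq C {a b} f g : rename.

Definition is_preorder (C : category) : Prop :=
  forall (a b : obj C) (f g : hom C a b), hom_eq C f g.

Lemma holds_equiv (P : Type) (X : equations P) (A B : formula P) :
  Equivalence (@holds P X A B).
Proof.
  split.
  - intros f; apply eq_refl_.
  - intros f g; apply eq_sym_.
  - intros f g h; apply eq_trans_.
Qed.

Definition term_category (P : Type) (X : equations P) : category :=
  @Category (formula P) (@term P) (@holds P X) (@One P) (@Comp P)
    (holds_equiv X) (@cong_comp P X) (@cat_right P X) (@cat_left P X)
    (@cat_assoc P X).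

Definition L (P : Type) : category := term_category (@no_equations P).

Definition L_plus (P : Type) (A B : formula P) (g1 g2 : term A B) : category :=
  term_category (instances g1 g2).

(* Main.v *)
Require Import Defs.
From Stdlib Require Import FinFun Morphisms Setoid Eqdep.


(** Replace every letter by one and the same formula [C].  The key fact,
    [fill_term_faithful], is that this substitution is faithful up to
    degeneracy: if the instances of [f] and [g] are equal modulo a set of
    equations [X], then either [f = g] already holds in [L], or [X] makes the
    two projections [C ∧ C ⊢ C] or the two injections [C ⊢ C ∨ C] equal.
    Suppose [g1 = g2] fails in [L], and let [X] consist of the instances of
    [g1 = g2].  Then the second alternative must hold, for every [C].  Any two
    arrows [D1 ⊢ D2] are then equal, as one sees by choosing [C = D1 ∨ D2]
    ([collapses_Or]).

    Faithfulness is shown by induction on a cut-free form of [f]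
    ([cut_elimination]): an arrow term built from identities of letters by
    pairing, copairing, precomposition with a projection and postcomposition
    with an injection.  Pairing and copairing are invertible, so these two
    cases are immediate.  Suppose that [f] ends with the first injection.
    Either [g] factors through that injection in [L], and one can cancel it,
    since injections have left inverses once all letters are the same; or [g]
    reaches the right summand on some input, and this separates [g] from [f]
    unless [X] identifies the injections.  Projections are dual.

    The inputs and outputs used as tests are the points [C ⊢ A[C]] and
    copoints [A[C] ⊢ C], where [A[C]] is [A] with all its letters replaced by
    [C]: those arrows that only duplicate, inject and project.  Arrows of [L]
    send points to points and copoints to copoints, and a copoint after a point
    is the identity of [C]; so every test reduces to a bare projection or
    injection of [C]. *)

Set Implicit Arguments.

Declare Scope arrow_scope.
Notation "g ∘ f" := (Comp g f) (at level 40, left associativity) : arrow_scope.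
Notation "f ≡[ X ] g" := (holds X f g)
  (at level 70, X at next level, no associativity) : arrow_scope.
Notation "f ≡ g" := (holds (@no_equations _) f g)
  (at level 70, no associativity) : arrow_scope.
Open Scope arrow_scope.

#[local] Hint Resolve eq_refl_ : core.

#[local] Existing Instance holds_equiv.

#[local] Instance Comp_proper (P : Type) (X : equations P) (A B C : formula P) :
  Proper (@holds P X B C ==> @holds P X A B ==> @holds P X A C) (@Comp P A B C).
Proof. intros g g' Hg f f' Hf. now apply cong_comp. Qed.

#[local] Instance BinT_proper (P : Type) (X : equations P) xi
  (A1 A2 B1 B2 : formula P) :
  Proper (@holds P X A1 B1 ==> @holds P X A2 B2
          ==> @holds P X (Bin xi A1 A2) (Bin xi B1 B2))
    (@BinT P xi A1 A2 B1 B2).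
Proof. intros f1 f1' H1 f2 f2' H2. now apply cong_bin. Qed.

(** * Products and coproducts *)

Definition pairing (P : Type) (A B1 B2 : formula P) (f1 : term A B1)
  (f2 : term A B2) : term A (And B1 B2) := AndT f1 f2 ∘ Wh A.

Definition copairing (P : Type) (A1 A2 B : formula P) (f1 : term A1 B)
  (f2 : term A2 B) : term (Or A1 A2) B := Wc B ∘ OrT f1 f2.

#[local] Instance pair_proper (P : Type) (X : equations P) (A B1 B2 : formula P) :
  Proper (@holds P X A B1 ==> @holds P X A B2 ==> @holds P X A (And B1 B2))
    (@pairing P A B1 B2).
Proof. intros f f' Hf g g' Hg. unfold pairing. now rewrite Hf, Hg. Qed.

#[local] Instance copair_proper (P : Type) (X : equations P) (A1 A2 B : formula P) :
  Proper (@holds P X A1 B ==> @holds P X A2 B ==> @holds P X (Or A1 A2) B)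
    (@copairing P A1 A2 B).
Proof. intros f f' Hf g g' Hg. unfold copairing. now rewrite Hf, Hg. Qed.

Lemma fst_pair (P : Type) (X : equations P) (A B1 B2 : formula P)
  (f1 : term A B1) (f2 : term A B2) : Kh1 B1 B2 ∘ pairing f1 f2 ≡[X] f1.
Proof.
  unfold pairing.
  now rewrite cat_assoc, <- nat_kh1, <- cat_assoc, tri_kh1, cat_right.
Qed.

Lemma snd_pair (P : Type) (X : equations P) (A B1 B2 : formula P)
  (f1 : term A B1) (f2 : term A B2) : Kh2 B1 B2 ∘ pairing f1 f2 ≡[X] f2.
Proof.
  unfold pairing.
  now rewrite cat_assoc, <- nat_kh2, <- cat_assoc, tri_kh2, cat_right.
Qed.

Lemma pair_comp (P : Type) (X : equations P) (A' A B1 B2 : formula P)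
  (f1 : term A B1) (f2 : term A B2) (h : term A' A) :
  pairing f1 f2 ∘ h ≡[X] pairing (f1 ∘ h) (f2 ∘ h).
Proof.
  unfold pairing. now rewrite bif_comp, <- !cat_assoc, nat_wh.
Qed.

Lemma pair_eta (P : Type) (X : equations P) (A B1 B2 : formula P)
  (f : term A (And B1 B2)) : pairing (Kh1 B1 B2 ∘ f) (Kh2 B1 B2 ∘ f) ≡[X] f.
Proof.
  rewrite <- pair_comp. unfold pairing. now rewrite tri_wh, cat_left.
Qed.

Lemma copair_inl (P : Type) (X : equations P) (A1 A2 B : formula P)
  (f1 : term A1 B) (f2 : term A2 B) : copairing f1 f2 ∘ Kc1 A1 A2 ≡[X] f1.
Proof.
  unfold copairing.
  now rewrite <- cat_assoc, nat_kc1, cat_assoc, tri_kc1, cat_left.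
Qed.

Lemma copair_inr (P : Type) (X : equations P) (A1 A2 B : formula P)
  (f1 : term A1 B) (f2 : term A2 B) : copairing f1 f2 ∘ Kc2 A1 A2 ≡[X] f2.
Proof.
  unfold copairing.
  now rewrite <- cat_assoc, nat_kc2, cat_assoc, tri_kc2, cat_left.
Qed.

Lemma comp_copair (P : Type) (X : equations P) (A1 A2 B B' : formula P)
  (f1 : term A1 B) (f2 : term A2 B) (h : term B B') :
  h ∘ copairing f1 f2 ≡[X] copairing (h ∘ f1) (h ∘ f2).
Proof.
  unfold copairing. now rewrite bif_comp, !cat_assoc, nat_wc.
Qed.

Lemma copair_eta (P : Type) (X : equations P) (A1 A2 B : formula P)
  (f : term (Or A1 A2) B) : copairing (f ∘ Kc1 A1 A2) (f ∘ Kc2 A1 A2) ≡[X] f.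
Proof.
  rewrite <- comp_copair. unfold copairing. now rewrite tri_wc, cat_right.
Qed.

Lemma AndT_pair (P : Type) (X : equations P) (A1 A2 B1 B2 : formula P)
  (f1 : term A1 B1) (f2 : term A2 B2) :
  AndT f1 f2 ≡[X] pairing (f1 ∘ Kh1 A1 A2) (f2 ∘ Kh2 A1 A2).
Proof. now rewrite nat_kh1, nat_kh2, pair_eta. Qed.

Lemma OrT_copair (P : Type) (X : equations P) (A1 A2 B1 B2 : formula P)
  (f1 : term A1 B1) (f2 : term A2 B2) :
  OrT f1 f2 ≡[X] copairing (Kc1 B1 B2 ∘ f1) (Kc2 B1 B2 ∘ f2).
Proof. now rewrite <- nat_kc1, <- nat_kc2, copair_eta. Qed.

Lemma Wh_pair (P : Type) (X : equations P) (A : formula P) :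
  Wh A ≡[X] pairing (One A) (One A).
Proof. unfold pairing. now rewrite bif_one, cat_left. Qed.

Lemma Wc_copair (P : Type) (X : equations P) (A : formula P) :
  Wc A ≡[X] copairing (One A) (One A).
Proof. unfold copairing. now rewrite bif_one, cat_right. Qed.

Lemma subst_term_holds (P : Type) (X : equations P) (s : P -> formula P)
  (A B : formula P) (f g : term A B) :
  f ≡ g -> subst_term s f ≡[X] subst_term s g.
Proof.
  induction 1; simpl;
    solve [ contradiction | now apply eq_sym_ | eapply eq_trans_; eassumption
          | constructor; assumption ].
Qed.

(** * Cut elimination *)

(** Derivations of a cut-free sequent calculus, closed under the equations of
    [L] so that having a cut-free form is a property of arrows. *)
Inductive cut_free (P : Type) : forall A B : formula P, term A B -> Prop :=
| cut_free_one : forall p, cut_free (One (Letter p))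
| cut_free_fst : forall A1 A2 B (f : term A1 B),
    cut_free f -> cut_free (f ∘ Kh1 A1 A2)
| cut_free_snd : forall A1 A2 B (f : term A2 B),
    cut_free f -> cut_free (f ∘ Kh2 A1 A2)
| cut_free_inl : forall A B1 B2 (f : term A B1),
    cut_free f -> cut_free (Kc1 B1 B2 ∘ f)
| cut_free_inr : forall A B1 B2 (f : term A B2),
    cut_free f -> cut_free (Kc2 B1 B2 ∘ f)
| cut_free_pair : forall A B1 B2 (f1 : term A B1) (f2 : term A B2),
    cut_free f1 -> cut_free f2 -> cut_free (pairing f1 f2)
| cut_free_copair : forall A1 A2 B (f1 : term A1 B) (f2 : term A2 B),
    cut_free f1 -> cut_free f2 -> cut_free (copairing f1 f2)
| cut_free_holds : forall A B (f g : term A B),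
    f ≡ g -> cut_free f -> cut_free g.

(** Invertibility of the right rule for conjunction.  Since the target is an
    index of [cut_free], the shape of [B] is imposed by a match so that the
    induction can range over all derivations. *)
Lemma cut_free_projections (P : Type) (A B : formula P) (f : term A B) :
  cut_free f ->
  match B as B0 return term A B0 -> Prop with
  | And B1 B2 => fun f => cut_free (Kh1 B1 B2 ∘ f) /\ cut_free (Kh2 B1 B2 ∘ f)
  | _ => fun _ => True
  end f.
Proof.
  induction 1 as [p|A1 A2 B f _ IH|A1 A2 B f _ IH|A B1 B2 f _ IH
    |A B1 B2 f _ IH|A B1 B2 f1 f2 H1 _ H2 _|A1 A2 B f1 f2 _ IH1 _ IH2
    |A B f g E _ IH]; simpl; try exact I.
  - destruct B as [|[] B1 B2]; try exact I. destruct IH as [IH1 IH2].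
    split; (eapply cut_free_holds; [symmetry; apply cat_assoc|]);
      now apply cut_free_fst.
  - destruct B as [|[] B1 B2]; try exact I. destruct IH as [IH1 IH2].
    split; (eapply cut_free_holds; [symmetry; apply cat_assoc|]);
      now apply cut_free_snd.
  - split; (eapply cut_free_holds; [|eassumption]); symmetry;
      [apply fst_pair|apply snd_pair].
  - destruct B as [|[] B1 B2]; try exact I.
    destruct IH1 as [IH11 IH12], IH2 as [IH21 IH22].
    split; (eapply cut_free_holds; [symmetry; apply comp_copair|]);
      now apply cut_free_copair.
  - destruct B as [|[] B1 B2]; try exact I. destruct IH as [IH1 IH2].
    split; (eapply cut_free_holds; [|eassumption]); now rewrite E.
Qed.

(** The principal case of cut elimination for disjunction; the two hypotheses
    on [g1] and [g2] are what the outer induction on the left factor gives. *)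
Lemma cut_free_copair_comp (P : Type) (A B : formula P) (f : term A B) :
  cut_free f ->
  match B as B0 return term A B0 -> Prop with
  | Or B1 B2 => fun f =>
      forall C (g1 : term B1 C) (g2 : term B2 C),
      (forall D (h : term D B1), cut_free h -> cut_free (g1 ∘ h)) ->
      (forall D (h : term D B2), cut_free h -> cut_free (g2 ∘ h)) ->
      cut_free (copairing g1 g2 ∘ f)
  | _ => fun _ => True
  end f.
Proof.
  induction 1 as [p|A1 A2 B f _ IH|A1 A2 B f _ IH|A B1 B2 f H _
    |A B1 B2 f H _|A B1 B2 f1 f2 _ _ _ _|A1 A2 B f1 f2 _ IH1 _ IH2
    |A B f g E _ IH]; simpl; try exact I.
  - destruct B as [|[] B1 B2]; try exact I. intros C g1 g2 H1 H2.
    eapply cut_free_holds; [symmetry; apply cat_assoc|].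
    apply cut_free_fst; auto.
  - destruct B as [|[] B1 B2]; try exact I. intros C g1 g2 H1 H2.
    eapply cut_free_holds; [symmetry; apply cat_assoc|].
    apply cut_free_snd; auto.
  - intros C g1 g2 H1 H2. apply cut_free_holds with (g1 ∘ f); auto.
    now rewrite cat_assoc, copair_inl.
  - intros C g1 g2 H1 H2. apply cut_free_holds with (g2 ∘ f); auto.
    now rewrite cat_assoc, copair_inr.
  - destruct B as [|[] B1 B2]; try exact I. intros C g1 g2 H1 H2.
    eapply cut_free_holds; [symmetry; apply comp_copair|].
    apply cut_free_copair; auto.
  - destruct B as [|[] B1 B2]; try exact I. intros C g1 g2 H1 H2.
    apply cut_free_holds with (copairing g1 g2 ∘ f); auto. now rewrite E.
Qed.

(** Induction on [g] alone suffices.  When [g] starts with a projection, the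
    projection is absorbed by [f]; when it is a copairing, [f] selects one of
    its components; otherwise the last rule of [g] commutes with the cut. *)
Lemma cut_free_comp (P : Type) (B C : formula P) (g : term B C) :
  cut_free g -> forall A (f : term A B), cut_free f -> cut_free (g ∘ f).
Proof.
  induction 1 as [p|A1 A2 B g _ IH|A1 A2 B g _ IH|A B1 B2 g _ IH
    |A B1 B2 g _ IH|A B1 B2 g1 g2 _ IH1 _ IH2|A1 A2 B g1 g2 _ IH1 _ IH2
    |A B g g' E _ IH]; intros D f Hf.
  - apply cut_free_holds with f; auto. now rewrite cat_left.
  - eapply cut_free_holds; [apply cat_assoc|].
    apply IH. apply (cut_free_projections Hf).
  - eapply cut_free_holds; [apply cat_assoc|].
    apply IH. apply (cut_free_projections Hf).
  - eapply cut_free_holds; [apply cat_assoc|]. apply cut_free_inl; auto.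
  - eapply cut_free_holds; [apply cat_assoc|]. apply cut_free_inr; auto.
  - eapply cut_free_holds; [symmetry; apply pair_comp|].
    apply cut_free_pair; auto.
  - apply (cut_free_copair_comp Hf); auto.
  - apply cut_free_holds with (g ∘ f); auto. now rewrite E.
Qed.

Lemma cut_free_identity (P : Type) (A : formula P) : cut_free (One A).
Proof.
  induction A as [p|[] A1 IH1 A2 IH2].
  - apply cut_free_one.
  - eapply cut_free_holds; [apply pair_eta|]. apply cut_free_pair.
    + eapply cut_free_holds; [|apply cut_free_fst, IH1].
      now rewrite cat_left, cat_right.
    + eapply cut_free_holds; [|apply cut_free_snd, IH2].
      now rewrite cat_left, cat_right.
  - eapply cut_free_holds; [apply copair_eta|]. apply cut_free_copair.
    + eapply cut_free_holds; [|apply cut_free_inl, IH1].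
      now rewrite cat_left, cat_right.
    + eapply cut_free_holds; [|apply cut_free_inr, IH2].
      now rewrite cat_left, cat_right.
Qed.

Theorem cut_elimination (P : Type) (A B : formula P) (f : term A B) :
  cut_free f.
Proof.
  induction f as [A|A|A|A1 A2|A1 A2|A1 A2|A1 A2|A B C g IHg f IHf
    |[] A1 A2 B1 B2 f1 IH1 f2 IH2].
  - apply cut_free_identity.
  - eapply cut_free_holds; [symmetry; apply Wh_pair|].
    apply cut_free_pair; apply cut_free_identity.
  - eapply cut_free_holds; [symmetry; apply Wc_copair|].
    apply cut_free_copair; apply cut_free_identity.
  - eapply cut_free_holds; [apply cat_left|].
    apply cut_free_fst, cut_free_identity.
  - eapply cut_free_holds; [apply cat_left|].
    apply cut_free_snd, cut_free_identity.
  - eapply cut_free_holds; [apply cat_right|].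
    apply cut_free_inl, cut_free_identity.
  - eapply cut_free_holds; [apply cat_right|].
    apply cut_free_inr, cut_free_identity.
  - now apply cut_free_comp.
  - eapply cut_free_holds; [symmetry; apply AndT_pair|].
    apply cut_free_pair; [now apply cut_free_fst|now apply cut_free_snd].
  - eapply cut_free_holds; [symmetry; apply OrT_copair|].
    apply cut_free_copair; [now apply cut_free_inl|now apply cut_free_inr].
Qed.

(** The only cut-free form of an arrow between letters is an identity.  For
    the induction the two letters must be distinct variables, hence the
    cast. *)
Lemma letter_arrow_is_identity (P : Type) (A B : formula P) (f : term A B) :
  cut_free f ->
  match A as A0, B as B0 return term A0 B0 -> Prop with
  | Letter p, Letter q => fun f =>
      exists e : p = q,
        f ≡ eq_rect p (fun q => term (Letter p) (Letter q)) (One (Letter p)) q e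
  | _, _ => fun _ => True
  end f.
Proof.
  induction 1 as [p|A1 A2 B f _ _|A1 A2 B f _ _|A B1 B2 f _ _
    |A B1 B2 f _ _|A B1 B2 f1 f2 _ _ _ _|A1 A2 B f1 f2 _ _ _ _
    |A B f g E _ IH]; simpl; try exact I; try (now destruct A).
  - now exists eq_refl.
  - destruct A, B; try exact I. destruct IH as [e H]. exists e.
    now rewrite <- E.
Qed.

Lemma letter_endomorphism (P : Type) (p : P)
  (f : term (Letter p) (Letter p)) : One (Letter p) ≡ f.
Proof.
  destruct (letter_arrow_is_identity (cut_elimination f)) as [e H].
  (* Only uniqueness of identity proofs makes the cast along [p = p] trivial. *)
  rewrite H. now rewrite (UIP_refl _ _ e).
Qed.

(** * Points and copoints of instances with a single formula *)

Notation fill C A := (subst_formula (fun _ => C) A).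
Notation fill_term C f := (subst_term (fun _ => C) f).

(** The [C]-instances of arrows from a letter [p] to the formula obtained from
    [A] by replacing each letter by [p]: a point of a conjunction is a pair of
    points, a point of a disjunction lies in one summand. *)
Fixpoint point (P : Type) (X : equations P) (C A : formula P) :
  term C (fill C A) -> Prop :=
  match A as A0 return term C (fill C A0) -> Prop with
  | Letter p => fun l => l ≡[X] One C
  | And A1 A2 => fun l =>
      point X A1 (Kh1 (fill C A1) (fill C A2) ∘ l) /\
      point X A2 (Kh2 (fill C A1) (fill C A2) ∘ l)
  | Or A1 A2 => fun l =>
      (exists a, point X A1 a /\ l ≡[X] Kc1 (fill C A1) (fill C A2) ∘ a) \/
      (exists a, point X A2 a /\ l ≡[X] Kc2 (fill C A1) (fill C A2) ∘ a)
  end.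

Fixpoint copoint (P : Type) (X : equations P) (C A : formula P) :
  term (fill C A) C -> Prop :=
  match A as A0 return term (fill C A0) C -> Prop with
  | Letter p => fun h => h ≡[X] One C
  | And A1 A2 => fun h =>
      (exists b, copoint X A1 b /\ h ≡[X] b ∘ Kh1 (fill C A1) (fill C A2)) \/
      (exists b, copoint X A2 b /\ h ≡[X] b ∘ Kh2 (fill C A1) (fill C A2))
  | Or A1 A2 => fun h =>
      copoint X A1 (h ∘ Kc1 (fill C A1) (fill C A2)) /\
      copoint X A2 (h ∘ Kc2 (fill C A1) (fill C A2))
  end.

#[local] Instance point_proper (P : Type) (X : equations P) (C A : formula P) :
  Proper (@holds P X C (fill C A) ==> iff) (@point P X C A).
Proof.
  induction A as [p|[] A1 IH1 A2 IH2]; intros l l' E; simpl.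
  - now rewrite E.
  - now rewrite E.
  - setoid_rewrite E. reflexivity.
Qed.

#[local] Instance copoint_proper (P : Type) (X : equations P) (C A : formula P) :
  Proper (@holds P X (fill C A) C ==> iff) (@copoint P X C A).
Proof.
  induction A as [p|[] A1 IH1 A2 IH2]; intros l l' E; simpl.
  - now rewrite E.
  - setoid_rewrite E. reflexivity.
  - now rewrite E.
Qed.

Lemma point_pair (P : Type) (X : equations P) (C A1 A2 : formula P)
  (a1 : term C (fill C A1)) (a2 : term C (fill C A2)) :
  point X A1 a1 -> point X A2 a2 -> point X (And A1 A2) (pairing a1 a2).
Proof. simpl. rewrite fst_pair, snd_pair. auto. Qed.

Lemma copoint_copair (P : Type) (X : equations P) (C A1 A2 : formula P)
  (b1 : term (fill C A1) C) (b2 : term (fill C A2) C) :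
  copoint X A1 b1 -> copoint X A2 b2 ->
  copoint X (Or A1 A2) (copairing b1 b2).
Proof. simpl. rewrite copair_inl, copair_inr. auto. Qed.

Lemma point_exists (P : Type) (X : equations P) (C A : formula P) :
  exists l : term C (fill C A), point X A l.
Proof.
  induction A as [p|[] A1 [a1 H1] A2 [a2 H2]].
  - exists (One C). apply eq_refl_.
  - exists (pairing a1 a2). now apply point_pair.
  - exists (Kc1 _ _ ∘ a1). left. eauto.
Qed.

Lemma copoint_exists (P : Type) (X : equations P) (C A : formula P) :
  exists h : term (fill C A) C, copoint X A h.
Proof.
  induction A as [p|[] A1 [b1 H1] A2 [b2 H2]].
  - exists (One C). apply eq_refl_.
  - exists (b1 ∘ Kh1 _ _). left. eauto.
  - exists (copairing b1 b2). now apply copoint_copair.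
Qed.

Lemma copoint_comp_point (P : Type) (X : equations P) (C A : formula P)
  (l : term C (fill C A)) (h : term (fill C A) C) :
  point X A l -> copoint X A h -> h ∘ l ≡[X] One C.
Proof.
  induction A as [p|[] A1 IH1 A2 IH2]; simpl.
  - intros -> ->. apply cat_left.
  - intros [H1 H2] [[b [Hb ->]]|[b [Hb ->]]]; rewrite <- cat_assoc; auto.
  - intros [[a [Ha ->]]|[a [Ha ->]]] [H1 H2]; rewrite cat_assoc; auto.
Qed.

Arguments copoint_comp_point {P X C A l h}.

Lemma point_image (P : Type) (X : equations P) (C A B : formula P)
  (f : term A B) (l : term C (fill C A)) :
  point X A l -> point X B (fill_term C f ∘ l).
Proof.
  revert l. induction (cut_elimination f) as [p|A1 A2 B f _ IH|A1 A2 B f _ IH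
    |A B1 B2 f _ IH|A B1 B2 f _ IH|A B1 B2 f1 f2 _ IH1 _ IH2
    |A1 A2 B f1 f2 _ IH1 _ IH2|A B f g E _ IH]; intros l Hl.
  - simpl in *. now rewrite cat_left.
  - destruct Hl as [H1 H2]. simpl. rewrite <- cat_assoc. auto.
  - destruct Hl as [H1 H2]. simpl. rewrite <- cat_assoc. auto.
  - left. exists (fill_term C f ∘ l). split; auto. simpl.
    now rewrite cat_assoc.
  - right. exists (fill_term C f ∘ l). split; auto. simpl.
    now rewrite cat_assoc.
  - change (fill_term C (pairing f1 f2))
      with (pairing (fill_term C f1) (fill_term C f2)).
    refine (proj2 (@point_proper P X C (And B1 B2) _ _ (pair_comp _ _ _ _)) _).
    apply point_pair; auto.
  - change (fill_term C (copairing f1 f2))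
      with (copairing (fill_term C f1) (fill_term C f2)).
    destruct Hl as [[a [Ha ->]]|[a [Ha ->]]]; rewrite cat_assoc;
      [rewrite (copair_inl X (fill_term C f1) (fill_term C f2))
      |rewrite (copair_inr X (fill_term C f1) (fill_term C f2))]; auto.
  - rewrite <- (subst_term_holds X (fun _ => C) E). auto.
Qed.

Lemma copoint_image (P : Type) (X : equations P) (C A B : formula P)
  (f : term A B) (h : term (fill C B) C) :
  copoint X B h -> copoint X A (h ∘ fill_term C f).
Proof.
  revert h. induction (cut_elimination f) as [p|A1 A2 B f _ IH|A1 A2 B f _ IH
    |A B1 B2 f _ IH|A B1 B2 f _ IH|A B1 B2 f1 f2 _ IH1 _ IH2
    |A1 A2 B f1 f2 _ IH1 _ IH2|A B f g E _ IH]; intros h Hh.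
  - simpl in *. now rewrite cat_right.
  - left. exists (h ∘ fill_term C f). split; auto. simpl.
    now rewrite cat_assoc.
  - right. exists (h ∘ fill_term C f). split; auto. simpl.
    now rewrite cat_assoc.
  - destruct Hh as [H1 H2]. simpl. rewrite cat_assoc. auto.
  - destruct Hh as [H1 H2]. simpl. rewrite cat_assoc. auto.
  - change (fill_term C (pairing f1 f2))
      with (pairing (fill_term C f1) (fill_term C f2)).
    destruct Hh as [[b [Hb ->]]|[b [Hb ->]]]; rewrite <- cat_assoc;
      [rewrite (fst_pair X (fill_term C f1) (fill_term C f2))
      |rewrite (snd_pair X (fill_term C f1) (fill_term C f2))]; auto.
  - change (fill_term C (copairing f1 f2))
      with (copairing (fill_term C f1) (fill_term C f2)).
    refine (proj2 (@copoint_proper P X C (Or A1 A2) _ _ (comp_copair _ _ _ _)) _).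
    apply copoint_copair; auto.
  - rewrite <- (subst_term_holds X (fun _ => C) E). auto.
Qed.

(** * Factoring through an injection or a projection *)

(** Disjunction property of arrows: the alternatives are decided by following a
    cut-free form of [f] down to its injections.  A copairing factors through
    the injection when both components do; a point on which one component
    reaches the right summand is also one for the copairing.  A projection is
    reached by a point whose other component is arbitrary. *)
Lemma factors_inl_or_point_inr (P : Type) (X : equations P) (C A B : formula P)
  (f : term A B) :
  match B as B0 return term A B0 -> Prop with
  | Or B1 B2 => fun f =>
      (exists f', f ≡ Kc1 B1 B2 ∘ f') \/
      (exists a b, point X A a /\ point X B2 b /\
         fill_term C f ∘ a ≡[X] Kc2 (fill C B1) (fill C B2) ∘ b)
  | _ => fun _ => True
  end f.
Proof.
  induction (cut_elimination f) as [p|A1 A2 B f _ IH|A1 A2 B f _ IH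
    |A B1 B2 f _ _|A B1 B2 f _ _|A B1 B2 f1 f2 _ _ _ _
    |A1 A2 B f1 f2 _ IH1 _ IH2|A B f g E _ IH]; simpl; try exact I.
  - destruct B as [|[] B1 B2]; try exact I; simpl in *.
    destruct IH as [[f' E]|[a [b [Ha [Hb E]]]]].
    + left. exists (f' ∘ Kh1 A1 A2). now rewrite E, cat_assoc.
    + right. destruct (point_exists X C A2) as [a2 Ha2].
      exists (pairing a a2), b. repeat split; auto.
      * now rewrite fst_pair.
      * now rewrite snd_pair.
      * now rewrite <- cat_assoc, fst_pair.
  - destruct B as [|[] B1 B2]; try exact I; simpl in *.
    destruct IH as [[f' E]|[a [b [Ha [Hb E]]]]].
    + left. exists (f' ∘ Kh2 A1 A2). now rewrite E, cat_assoc.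
    + right. destruct (point_exists X C A1) as [a1 Ha1].
      exists (pairing a1 a), b. repeat split; auto.
      * now rewrite fst_pair.
      * now rewrite snd_pair.
      * now rewrite <- cat_assoc, snd_pair.
  - left. now exists f.
  - right. destruct (point_exists X C A) as [a Ha].
    exists a, (fill_term C f ∘ a). repeat split; auto.
    + now apply point_image.
    + now rewrite cat_assoc.
  - destruct B as [|[] B1 B2]; try exact I; simpl in *.
    change (Wc (fill C (Or B1 B2)) ∘ OrT (fill_term C f1) (fill_term C f2))
      with (copairing (fill_term C f1) (fill_term C f2)).
    destruct IH1 as [[f1' E1]|[a [b [Ha [Hb E]]]]].
    + destruct IH2 as [[f2' E2]|[a [b [Ha [Hb E]]]]].
      * left. exists (copairing f1' f2'). now rewrite comp_copair, E1, E2.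
      * right. exists (Kc2 _ _ ∘ a), b. repeat split; eauto.
        rewrite cat_assoc.
        now rewrite (copair_inr X (fill_term C f1) (fill_term C f2)).
    + right. exists (Kc1 _ _ ∘ a), b. repeat split; eauto.
      rewrite cat_assoc.
      now rewrite (copair_inl X (fill_term C f1) (fill_term C f2)).
  - destruct B as [|[] B1 B2]; try exact I; simpl in *.
    destruct IH as [[f' E']|[a [b [Ha [Hb E']]]]].
    + left. exists f'. now rewrite <- E.
    + right. exists a, b. repeat split; auto.
      now rewrite <- (subst_term_holds X (fun _ => C) E).
Qed.

Definition swap_And (P : Type) (A B : formula P) : term (And A B) (And B A) :=
  pairing (Kh2 A B) (Kh1 A B).

Definition swap_Or (P : Type) (A B : formula P) : term (Or A B) (Or B A) :=
  copairing (Kc2 B A) (Kc1 B A).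

Lemma swap_And_involutive (P : Type) (X : equations P) (A B : formula P) :
  swap_And A B ∘ swap_And B A ≡[X] One (And B A).
Proof.
  unfold swap_And. rewrite pair_comp, fst_pair, snd_pair.
  rewrite <- (cat_right X (Kh1 B A)), <- (cat_right X (Kh2 B A)).
  apply pair_eta.
Qed.

Lemma swap_Or_involutive (P : Type) (X : equations P) (A B : formula P) :
  swap_Or A B ∘ swap_Or B A ≡[X] One (Or B A).
Proof.
  unfold swap_Or. rewrite comp_copair, copair_inl, copair_inr.
  rewrite <- (cat_left X (Kc1 B A)), <- (cat_left X (Kc2 B A)).
  apply copair_eta.
Qed.

Lemma swap_Or_inv (P : Type) (X : equations P) (A B1 B2 : formula P)
  (f : term A (Or B1 B2)) (g : term A (Or B2 B1)) :
  swap_Or B1 B2 ∘ f ≡[X] g -> f ≡[X] swap_Or B2 B1 ∘ g.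
Proof.
  intros <-. now rewrite cat_assoc, swap_Or_involutive, cat_left.
Qed.

Lemma swap_And_inv (P : Type) (X : equations P) (A1 A2 B : formula P)
  (f : term (And A1 A2) B) (g : term (And A2 A1) B) :
  f ∘ swap_And A2 A1 ≡[X] g -> f ≡[X] g ∘ swap_And A1 A2.
Proof.
  intros <-. now rewrite <- cat_assoc, swap_And_involutive, cat_right.
Qed.

Lemma factors_inr_or_point_inl (P : Type) (X : equations P)
  (C A B1 B2 : formula P) (f : term A (Or B1 B2)) :
  (exists f', f ≡ Kc2 B1 B2 ∘ f') \/
  (exists a b, point X A a /\ point X B1 b /\
     fill_term C f ∘ a ≡[X] Kc1 (fill C B1) (fill C B2) ∘ b).
Proof.
  destruct (factors_inl_or_point_inr X C (swap_Or B1 B2 ∘ f))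
    as [[f' E]|[a [b [Ha [Hb E]]]]].
  - left. exists f'. apply swap_Or_inv in E.
    rewrite E, cat_assoc. unfold swap_Or. now rewrite copair_inl.
  - right. exists a, b. repeat split; auto.
    change (fill_term C (swap_Or B1 B2 ∘ f))
      with (swap_Or (fill C B1) (fill C B2) ∘ fill_term C f) in E.
    rewrite <- cat_assoc in E. apply swap_Or_inv in E.
    rewrite E, cat_assoc. unfold swap_Or. now rewrite copair_inr.
Qed.

Lemma factors_fst_or_copoint_snd (P : Type) (X : equations P) (C A B : formula P)
  (f : term A B) :
  match A as A0 return term A0 B -> Prop with
  | And A1 A2 => fun f =>
      (exists f', f ≡ f' ∘ Kh1 A1 A2) \/
      (exists h b, copoint X B h /\ copoint X A2 b /\
         h ∘ fill_term C f ≡[X] b ∘ Kh2 (fill C A1) (fill C A2))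
  | _ => fun _ => True
  end f.
Proof.
  induction (cut_elimination f) as [p|A1 A2 B f _ _|A1 A2 B f _ _
    |A B1 B2 f _ IH|A B1 B2 f _ IH|A B1 B2 f1 f2 _ IH1 _ IH2
    |A1 A2 B f1 f2 _ _ _ _|A B f g E _ IH]; simpl; try exact I.
  - left. now exists f.
  - right. destruct (copoint_exists X C B) as [h Hh].
    exists h, (h ∘ fill_term C f). repeat split; auto.
    + now apply copoint_image.
    + now rewrite cat_assoc.
  - destruct A as [|[] A1 A2]; try exact I; simpl in *.
    destruct IH as [[f' E]|[h [b [Hh [Hb E]]]]].
    + left. exists (Kc1 B1 B2 ∘ f'). now rewrite E, cat_assoc.
    + right. destruct (copoint_exists X C B2) as [h2 Hh2].
      exists (copairing h h2), b. repeat split; auto.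
      * now rewrite copair_inl.
      * now rewrite copair_inr.
      * now rewrite cat_assoc, copair_inl.
  - destruct A as [|[] A1 A2]; try exact I; simpl in *.
    destruct IH as [[f' E]|[h [b [Hh [Hb E]]]]].
    + left. exists (Kc2 B1 B2 ∘ f'). now rewrite E, cat_assoc.
    + right. destruct (copoint_exists X C B1) as [h1 Hh1].
      exists (copairing h1 h), b. repeat split; auto.
      * now rewrite copair_inl.
      * now rewrite copair_inr.
      * now rewrite cat_assoc, copair_inr.
  - destruct A as [|[] A1 A2]; try exact I; simpl in *.
    change (AndT (fill_term C f1) (fill_term C f2) ∘ Wh (fill C (And A1 A2)))
      with (pairing (fill_term C f1) (fill_term C f2)).
    destruct IH1 as [[f1' E1]|[h [b [Hh [Hb E]]]]].
    + destruct IH2 as [[f2' E2]|[h [b [Hh [Hb E]]]]].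
      * left. exists (pairing f1' f2'). now rewrite pair_comp, E1, E2.
      * right. exists (h ∘ Kh2 _ _), b. repeat split; eauto.
        rewrite <- cat_assoc.
        now rewrite (snd_pair X (fill_term C f1) (fill_term C f2)).
    + right. exists (h ∘ Kh1 _ _), b. repeat split; eauto.
      rewrite <- cat_assoc.
      now rewrite (fst_pair X (fill_term C f1) (fill_term C f2)).
  - destruct A as [|[] A1 A2]; try exact I; simpl in *.
    destruct IH as [[f' E']|[h [b [Hh [Hb E']]]]].
    + left. exists f'. now rewrite <- E.
    + right. exists h, b. repeat split; auto.
      now rewrite <- (subst_term_holds X (fun _ => C) E).
Qed.

Lemma factors_snd_or_copoint_fst (P : Type) (X : equations P)
  (C A1 A2 B : formula P) (f : term (And A1 A2) B) :
  (exists f', f ≡ f' ∘ Kh2 A1 A2) \/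
  (exists h b, copoint X B h /\ copoint X A1 b /\
     h ∘ fill_term C f ≡[X] b ∘ Kh1 (fill C A1) (fill C A2)).
Proof.
  destruct (factors_fst_or_copoint_snd X C (f ∘ swap_And A2 A1))
    as [[f' E]|[h [b [Hh [Hb E]]]]].
  - left. exists f'. apply swap_And_inv in E.
    rewrite E, <- cat_assoc. unfold swap_And. now rewrite fst_pair.
  - right. exists h, b. repeat split; auto.
    change (fill_term C (f ∘ swap_And A2 A1))
      with (fill_term C f ∘ swap_And (fill C A2) (fill C A1)) in E.
    rewrite cat_assoc in E. apply swap_And_inv in E.
    rewrite E, <- cat_assoc. unfold swap_And. now rewrite snd_pair.
Qed.

(** * Maximality *)

Definition collapses (P : Type) (X : equations P) (C : formula P) : Prop :=
  Kh1 C C ≡[X] Kh2 C C \/ Kc1 C C ≡[X] Kc2 C C.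

(** In a filled formula every summand maps to every other: a copoint followed
    by a point.  So an injection has a left inverse, which it need not have
    before the letters are identified. *)
Lemma fill_Kc1_mono (P : Type) (X : equations P) (C A B1 B2 : formula P)
  (f g : term A (fill C B1)) :
  Kc1 (fill C B1) (fill C B2) ∘ f ≡[X] Kc1 (fill C B1) (fill C B2) ∘ g ->
  f ≡[X] g.
Proof.
  intros E. destruct (point_exists X C B1) as [l _].
  destruct (copoint_exists X C B2) as [h _].
  rewrite <- (cat_left X f), <- (cat_left X g).
  rewrite <- (copair_inl X (One _) (l ∘ h)).
  now rewrite <- !cat_assoc, E.
Qed.

Lemma fill_Kc2_mono (P : Type) (X : equations P) (C A B1 B2 : formula P)
  (f g : term A (fill C B2)) :
  Kc2 (fill C B1) (fill C B2) ∘ f ≡[X] Kc2 (fill C B1) (fill C B2) ∘ g ->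
  f ≡[X] g.
Proof.
  intros E. destruct (point_exists X C B2) as [l _].
  destruct (copoint_exists X C B1) as [h _].
  rewrite <- (cat_left X f), <- (cat_left X g).
  rewrite <- (copair_inr X (l ∘ h) (One _)).
  now rewrite <- !cat_assoc, E.
Qed.

Lemma fill_Kh1_epi (P : Type) (X : equations P) (C A1 A2 B : formula P)
  (f g : term (fill C A1) B) :
  f ∘ Kh1 (fill C A1) (fill C A2) ≡[X] g ∘ Kh1 (fill C A1) (fill C A2) ->
  f ≡[X] g.
Proof.
  intros E. destruct (point_exists X C A2) as [l _].
  destruct (copoint_exists X C A1) as [h _].
  rewrite <- (cat_right X f), <- (cat_right X g).
  rewrite <- (fst_pair X (One _) (l ∘ h)).
  now rewrite !cat_assoc, E.
Qed.

Lemma fill_Kh2_epi (P : Type) (X : equations P) (C A1 A2 B : formula P)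
  (f g : term (fill C A2) B) :
  f ∘ Kh2 (fill C A1) (fill C A2) ≡[X] g ∘ Kh2 (fill C A1) (fill C A2) ->
  f ≡[X] g.
Proof.
  intros E. destruct (point_exists X C A1) as [l _].
  destruct (copoint_exists X C A2) as [h _].
  rewrite <- (cat_right X f), <- (cat_right X g).
  rewrite <- (snd_pair X (l ∘ h) (One _)).
  now rewrite !cat_assoc, E.
Qed.

(** Two copoints, put side by side, turn the equation between points of the two
    summands into one between the injections of [C]. *)
Lemma collapses_Kc (P : Type) (X : equations P) (C B1 B2 : formula P)
  (b1 : term C (fill C B1)) (b2 : term C (fill C B2)) :
  point X B1 b1 -> point X B2 b2 ->
  Kc1 (fill C B1) (fill C B2) ∘ b1 ≡[X] Kc2 (fill C B1) (fill C B2) ∘ b2 ->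
  collapses X C.
Proof.
  intros H1 H2 E. right.
  destruct (copoint_exists X C B1) as [h1 Hh1].
  destruct (copoint_exists X C B2) as [h2 Hh2].
  apply (cong_comp (eq_refl_ X (OrT h1 h2))) in E.
  rewrite !cat_assoc, nat_kc1, nat_kc2, <- !cat_assoc in E.
  rewrite (copoint_comp_point H1 Hh1), (copoint_comp_point H2 Hh2) in E.
  now rewrite !cat_right in E.
Qed.

Lemma collapses_Kh (P : Type) (X : equations P) (C A1 A2 : formula P)
  (b1 : term (fill C A1) C) (b2 : term (fill C A2) C) :
  copoint X A1 b1 -> copoint X A2 b2 ->
  b1 ∘ Kh1 (fill C A1) (fill C A2) ≡[X] b2 ∘ Kh2 (fill C A1) (fill C A2) ->
  collapses X C.
Proof.
  intros H1 H2 E. left.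
  destruct (point_exists X C A1) as [l1 Hl1].
  destruct (point_exists X C A2) as [l2 Hl2].
  apply (fun E => cong_comp E (eq_refl_ X (AndT l1 l2))) in E.
  rewrite <- !cat_assoc, <- nat_kh1, <- nat_kh2, !cat_assoc in E.
  rewrite (copoint_comp_point Hl1 H1), (copoint_comp_point Hl2 H2) in E.
  now rewrite !cat_left in E.
Qed.

(** Each rule at the end of [f] is matched against [g]: either [g] ends with
    the same rule, which cancels, or a test by a point or copoint tells the two
    apart. *)
Lemma fill_term_faithful (P : Type) (X : equations P) (C A B : formula P)
  (f g : term A B) :
  fill_term C f ≡[X] fill_term C g -> f ≡ g \/ collapses X C.
Proof.
  revert g. induction (cut_elimination f) as [p|A1 A2 B f _ IH|A1 A2 B f _ IH
    |A B1 B2 f _ IH|A B1 B2 f _ IH|A B1 B2 f1 f2 _ IH1 _ IH2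
    |A1 A2 B f1 f2 _ IH1 _ IH2|A B f f' E _ IH]; intros g H.
  - left. apply letter_endomorphism.
  - destruct (factors_fst_or_copoint_snd X C g)
      as [[g' E]|[h [b [Hh [Hb E]]]]].
    + rewrite (subst_term_holds X (fun _ => C) E) in H.
      apply fill_Kh1_epi in H. destruct (IH _ H) as [H'|H']; [|now right].
      left. now rewrite E, H'.
    + right. rewrite <- H in E. simpl in E. rewrite cat_assoc in E.
      refine (collapses_Kh _ _ _ _ E); auto. now apply copoint_image.
  - destruct (factors_snd_or_copoint_fst X C g)
      as [[g' E]|[h [b [Hh [Hb E]]]]].
    + rewrite (subst_term_holds X (fun _ => C) E) in H.
      apply fill_Kh2_epi in H. destruct (IH _ H) as [H'|H']; [|now right].
      left. now rewrite E, H'.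
    + right. rewrite <- H in E. simpl in E. rewrite cat_assoc in E.
      apply eq_sym_ in E.
      refine (collapses_Kh _ _ _ _ E); auto. now apply copoint_image.
  - destruct (factors_inl_or_point_inr X C g)
      as [[g' E]|[a [b [Ha [Hb E]]]]].
    + rewrite (subst_term_holds X (fun _ => C) E) in H.
      apply fill_Kc1_mono in H. destruct (IH _ H) as [H'|H']; [|now right].
      left. now rewrite E, H'.
    + right. rewrite <- H in E. simpl in E. rewrite <- cat_assoc in E.
      refine (collapses_Kc _ _ _ _ E); auto. now apply point_image.
  - destruct (factors_inr_or_point_inl X C g)
      as [[g' E]|[a [b [Ha [Hb E]]]]].
    + rewrite (subst_term_holds X (fun _ => C) E) in H.
      apply fill_Kc2_mono in H. destruct (IH _ H) as [H'|H']; [|now right].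
      left. now rewrite E, H'.
    + right. rewrite <- H in E. simpl in E. rewrite <- cat_assoc in E.
      apply eq_sym_ in E.
      refine (collapses_Kc _ _ _ _ E); auto. now apply point_image.
  - change (pairing (fill_term C f1) (fill_term C f2) ≡[X] fill_term C g) in H.
    destruct (IH1 (Kh1 B1 B2 ∘ g)) as [E1|]; [| |now right].
    { simpl. now rewrite <- H, fst_pair. }
    destruct (IH2 (Kh2 B1 B2 ∘ g)) as [E2|]; [| |now right].
    { simpl. now rewrite <- H, snd_pair. }
    left. now rewrite E1, E2, pair_eta.
  - change (copairing (fill_term C f1) (fill_term C f2) ≡[X] fill_term C g) in H.
    destruct (IH1 (g ∘ Kc1 A1 A2)) as [E1|]; [| |now right].
    { simpl. now rewrite <- H, copair_inl. }
    destruct (IH2 (g ∘ Kc2 A1 A2)) as [E2|]; [| |now right].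
    { simpl. now rewrite <- H, copair_inr. }
    left. now rewrite E1, E2, copair_eta.
  - rewrite <- (subst_term_holds X (fun _ => C) E) in H.
    destruct (IH _ H) as [H'|H']; [left|now right]. now rewrite <- E.
Qed.

(** Equal projections of [C] identify all arrows with target [C]; equal
    injections identify all arrows with source [C].  For [C = A ∨ B], the arrow [f]
    can be recovered both from [Kc2 A B ∘ f], which has target [C], and from
    the copairing of [f] with the identity, which has source [C]. *)
Lemma collapses_Or (P : Type) (X : equations P) (A B : formula P)
  (f g : term A B) : collapses X (Or A B) -> f ≡[X] g.
Proof.
  intros [H|H].
  - assert (E : Kc2 A B ∘ f ≡[X] Kc2 A B ∘ g).
    { rewrite <- (fst_pair X (Kc2 A B ∘ f) (Kc2 A B ∘ g)), H.
      apply snd_pair. }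
    rewrite <- (cat_left X f), <- (cat_left X g).
    rewrite <- (copair_inr X f (One B)).
    now rewrite <- !cat_assoc, E.
  - rewrite <- (copair_inl X f (One B)), <- (copair_inl X g (One B)).
    rewrite <- (copair_inl X (copairing f (One B)) (copairing g (One B))).
    rewrite H. now rewrite copair_inr.
Qed.

Theorem mainTheorem12 (P : Type) (P_infinite : ~ Finite P)
  (A B : formula P) (g1 g2 : term A B) :
  ~ hom_eq (L P) g1 g2 -> is_preorder (L_plus g1 g2).
Proof.
  intros N D1 D2 f g. apply collapses_Or.
  destruct (@fill_term_faithful P (instances g1 g2) (Or D1 D2) A B g1 g2)
    as [H|H]; trivial.
  - apply ax_new, instance.
  - now destruct N.
Qed.
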